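(* Let $\mathcal{G}$ be the class of all finite groups. The function $\psi'':\mathcal{G}\longrightarrow(0,1]$, $G\mapsto\psi''(G)$, is not surjective.
   Context: For a finite group $G$ and $x\in G$, $o(x)$ denotes the order of $x$. The sum of element orders of $G$ is $\psi(G)=\sum_{x\in G}o(x)$, and $\psi''(G)=\frac{\psi(G)}{|G|^2}$. One has $\psi''(G)\in(0,1]$ for every finite group $G$. The codomain of $\psi''$ is the set of all real numbers in $(0,1]$. *)

(* Defs.v *)
From mathcomp Require Import all_boot all_order all_algebra all_fingroup.
From mathcomp Require Import reals.

Set Implicit Arguments.
Unset Strict Implicit.
Unset Printing Implicit Defensive.

Import Order.TTheory GRing.Theory Num.Theory.
Local Open Scope ring_scope.

(* Subgroups of an ambient finGroupType; carrier = [set: ambient] already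
   gives every finite group.  The universe of this type is too large for it to
   be the domain of the set-theoretic functions of mathcomp.classical. *)
Record finite_group := FiniteGroup {
  ambient : finGroupType;
  carrier : {group ambient} }.

Definition psi (G : finite_group) : nat :=
  (\sum_(x in carrier G) #[x]%g)%N.

Definition psi2_real (R : realType) (G : finite_group) : R :=
  (psi G)%:R / #|carrier G|%:R ^+ 2.

Lemma psi2_real_in (R : realType) (G : finite_group) :
  0 < psi2_real R G <= 1.
Proof.
have cG : 0 < #|carrier G|%:R :> R by rewrite ltr0n cardG_gt0.
rewrite /psi2_real; apply/andP; split.
  rewrite divr_gt0 ?exprn_gt0 // ltr0n /psi (bigD1 1%g) ?group1 //=.
  by rewrite order1.
rewrite ler_pdivrMr ?exprn_gt0 // mul1r -natrX ler_nat /psi.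
rewrite -mulnn -sum_nat_const; apply: leq_sum => x xG.
by rewrite subset_leq_card ?cycle_subG.
Qed.

Definition psi2 (R : realType) (G : finite_group) : {y : R | 0 < y <= 1} :=
  exist _ (psi2_real R G) (psi2_real_in R G).

(* Main.v *)
(* Every value of psi'' is rational, whereas (0, 1] contains 1/sqrt 2, which is
   not: psi(G) / n^2 = 1/sqrt 2 gives 2 psi(G)^2 = n^4, and the 2-adic valuation
   is odd on the left and even on the right. *)
Require Import Defs.
From mathcomp Require Import all_boot all_order all_algebra all_fingroup.
From mathcomp Require Import reals.
Import Order.TTheory GRing.Theory Num.Theory.
Local Open Scope ring_scope.

Lemma double_sqr_neq_sqr (a b : nat) :
  (0 < a)%N -> (0 < b)%N -> (2 * a ^ 2)%N <> (b ^ 2)%N.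
Proof.
move=> a0 b0 /(congr1 (logn 2)).
(* Positivity lets [logn] turn the product into a sum, as [logn 2 0 = 0]. With v the 2-adic
   valuation, this leaves 1 + 2 v(a) = 2 v(b). *)
rewrite lognM ?expn_gt0 ?a0 // !lognX logn_prime // eqxx !mul2n.
by move/(congr1 odd); rewrite oddD !odd_double.
Qed.

Lemma psi_gt0 (G : finite_group) : (0 < psi G)%N.
Proof. by rewrite /psi (bigD1 1%g) ?group1 //= order1. Qed.

Theorem proposition1p4 (R : realType) :
  ~ (forall y : {y : R | 0 < y <= 1},
       exists G : finite_group, psi2 R G = y).
Proof.
move=> surj.
have y01 : 0 < Num.sqrt (2%:R^-1 : R) <= 1.
  rewrite sqrtr_gt0 invr_gt0 ltr0n /= -[leRHS]sqrtr1 ler_sqrt ?ler01 //.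
  by rewrite invf_le1 ?ltr0n // ler1n.
(* Projecting to [R] and squaring removes the root: psi(G)^2 / (n^2)^2 = 1/2 with n = |G|. *)
have [G /(congr1 (fun z => sval z ^+ 2))] := surj (exist (fun y : R => 0 < y <= 1) _ y01).
rewrite /= sqr_sqrtr ?invr_ge0 ?ler0n // /psi2_real expr_div_n => psi_sqr.
apply: (@double_sqr_neq_sqr (psi G) (#|carrier G| ^ 2)).
- exact: psi_gt0.
- by rewrite expn_gt0 cardG_gt0.
(* Naturals embed injectively in [R], so the integer identity follows from [psi_sqr] by clearing
   denominators. *)
apply/eqP; rewrite -(eqr_nat R) natrM !natrX.
move/eqP: psi_sqr; rewrite -[2^-1]div1r eqr_div ?expf_neq0 ?pnatr_eq0 -?lt0n ?cardG_gt0 // mul1r.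
by rewrite mulrC.
Qed.
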